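(* Let $P_2$ be the set of $30$ binary words listed in the context. Then for every $n\ge0$ the code $C_n(P_2)=P_2^*\cap\{0,1\}^n$ is correcting, i.e. $B(c)\cap B(c')=\emptyset$ for all distinct $c,c'\in C_n(P_2)$. Moreover, if $\lambda_2$ is the unique positive solution of $$6\lambda_2^{-6}+8\lambda_2^{-7}+2\lambda_2^{-8}+10\lambda_2^{-9}+4\lambda_2^{-11}=1,$$ then $|C_n(P_2)|=\lambda_2^{\,n+o(n)}$ along the lengths $n\to\infty$ with $C_n(P_2)\ne\emptyset$, so the asymptotic rate of the family is $\log_2\lambda_2$, and $\log_2\lambda_2\approx0.649872$ (with error less than $10^{-6}$).
   Context: For $c\in\{0,1\}^n$, the radius-one ball $B(c)$ is the set of all words $z=z_1\cdots z_n$ with $z_i=c_{\pi(i)}$ for some permutation $\pi$ of $\{1,\dots,n\}$ satisfying $|\pi(i)-i|\le 1$ for all $i$; equivalently, all words obtained from $c$ by swapping the symbols in any set of pairwise disjoint pairs of adjacent positions. For a set $P$ of nonempty binary words, $P^*$ is the set of all finite concatenations (including the empty one) of words in $P$. The set $P_2$ consists of the following words. Length 6: 000000, 000111, 001111, 110000, 111000, 111111. Length 7: 0000111, 0001000, 0111000, 0111111, 1000000, 1000111, 1110111, 1111000. Length 8: 01111000, 10000111. Length 9: 000001111, 000110000, 001110000, 011101111, 011111000, 100000111, 100010000, 110001111, 111001111, 111110000. Length 11: 00110000111, 01111001111, 10000110000, 11001111000. *)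

(* Defs.v *)
From HB Require Import structures.
From Stdlib Require Import Ascii String.
From mathcomp Require Import all_boot all_order all_algebra perm.
From mathcomp Require Import boolp classical_sets reals topology normedtype.
From mathcomp Require Import landau sequences exp.
Import Order.TTheory GRing.Theory Num.Theory.
Import numFieldNormedType.Exports.

Set Implicit Arguments.
Unset Strict Implicit.
Unset Printing Implicit Defensive.

Definition word := seq bool.

Definition radius_one_ball n (c : n.-tuple bool) : {set n.-tuple bool} :=
  [set z : n.-tuple bool | [exists s : 'S_n,
     [forall i : 'I_n, (`|s i - i| <= 1)%N] &&
     [forall i : 'I_n, tnth z i == tnth c (s i)]]].

Definition correcting n (C : {set n.-tuple bool}) : Prop :=
  forall c c', c \in C -> c' \in C -> c != c' ->
    [disjoint radius_one_ball c & radius_one_ball c'].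

Definition kleene_star (P : seq word) (w : word) : Prop :=
  exists2 ws : seq word, {subset ws <= P} & w = flatten ws.

Definition code (P : seq word) n : {set n.-tuple bool} :=
  [set c : n.-tuple bool | `[< kleene_star P c >]].

(* The bit string written with the characters 0 and 1. *)
Definition bits (s : String.string) : word :=
  [seq Ascii.eqb a "1"%char | a <- String.list_ascii_of_string s].

Definition P2 : seq word := map bits (
  [:: "000000"; "000111"; "001111"; "110000"; "111000"; "111111";
      "0000111"; "0001000"; "0111000"; "0111111";
      "1000000"; "1000111"; "1110111"; "1111000";
      "01111000"; "10000111";
      "000001111"; "000110000"; "001110000"; "011101111"; "011111000";
      "100000111"; "100010000"; "110001111"; "111001111"; "111110000";
      "00110000111"; "01111001111"; "10000110000"; "11001111000"]%string).

Local Open Scope ring_scope.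
Local Open Scope classical_set_scope.

Definition log2 (R : realType) (x : R) : R := ln x / ln 2.

(* The rate is the limit of log2 |C_n| / n along the lengths n at which C_n is
   nonempty; the first conjunct says that there are infinitely many of them,
   without which the limit would be meaningless. *)
Definition has_asymptotic_rate (R : realType)
    (C : forall n, {set n.-tuple bool}) (r : R) : Prop :=
  (forall N, exists2 n, (N <= n)%N & C n != finset.set0) /\
  (log2 (#|C n|%:R : R) / n%:R @[n --> within [set n | C n != finset.set0] \oo]
     --> r).

(* Main.v *)
(* Correcting. Two codewords whose balls share a word z are read from left to
   right, simultaneously with z. The reader of a codeword remembers the prefix
   of the word of P2 under way (no such word is a prefix of another) and at most
   one bit displaced by a pending swap. The pairs of readers
   reachable from the start, each with a flag telling whether the two inputs
   have differed, form a finite set (621 elements) that never returns to the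
   start with the flag set.

   Size. Unique factorisation gives |C_n| = sum_p |C_(n-|p|)| over the words p
   of P2, and lambda_2 solves sum_p x^(-|p|) = 1, so that induction on n yields
   |C_n| <= x^n and, as C_11, ..., C_21 are nonempty, x^n <= x^22 |C_n|. *)
Require Import Defs.
From mathcomp Require Import all_boot all_order all_algebra.
From mathcomp Require Import boolp classical_sets reals topology normedtype.
From mathcomp Require Import landau sequences exp.
From mathcomp Require Import perm zify ring lra.
Import Order.TTheory GRing.Theory Num.Theory.
Import numFieldNormedType.Exports.

(** * Swaps as a finite transducer *)

(* The state [p = Some o] means that the symbol just read was swapped with the
   next one: the next output is [o] and the next input is [~~ o], swaps of equal
   symbols being superfluous. *)
Definition emit (p : option bool) (a : bool) : seq (bool * option bool) :=
  match p with
  | None => [:: (a, None); (~~ a, Some a)]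
  | Some o => if a == ~~ o then [:: (o, None)] else [::]
  end.

Fixpoint swaps (p : option bool) (c z : word) : bool :=
  match c, z with
  | [::], [::] => p == None
  | a :: c', o :: z' => has (fun e => (e.1 == o) && swaps e.2 c' z') (emit p a)
  | _, _ => false
  end.

Lemma swaps_keep a c z : swaps None c z -> swaps None (a :: c) (a :: z).
Proof. by move=> h; rewrite /= eqxx h. Qed.

(** Distinct symbols pass through a pending state; exchanging equal ones is invisible and is read as
    two unswapped symbols. *)
Lemma swaps_swap a b c z :
  swaps None c z -> swaps None (a :: b :: c) (b :: a :: z).
Proof.
by move=> h; case: a; case: b; rewrite /= ?h.
Qed.

(** A permutation moving every index by at most one is a product of disjoint adjacent
    transpositions, peeled off here from the left. *)
Lemma ball_swaps n (c z : n.-tuple bool) :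
  z \in radius_one_ball c -> swaps None c z.
Proof.
rewrite inE => /existsP[s /andP[/forallP near /forallP zE]].
have zc (i : 'I_n) : nth false z i = nth false c (s i).
  by rewrite -!tnth_nth; apply/eqP.
have dropE (w : n.-tuple bool) k : (k < n)%N ->
    drop k w = nth false w k :: drop k.+1 w.
  by move=> ltkn; rewrite (drop_nth false) ?size_tuple.
(* The positions from k on are stable under s: no swap straddles k. *)
suff: forall m k, (n - k <= m)%N ->
    (forall i : 'I_n, (k <= s i)%N = (k <= i)%N) ->
    swaps None (drop k c) (drop k z).
  by move=> /(_ n 0); rewrite !drop0; apply => //; lia.
elim=> [|m IH] k le_nk stab.
  by rewrite !drop_oversize ?size_tuple //; lia.
have [le_n_k|lt_k_n] := leqP n k.
  by rewrite !drop_oversize ?size_tuple.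
pose K := Ordinal lt_k_n.
rewrite !(dropE _ k) //.
rewrite (zc K).
have := stab K; rewrite leqnn => k_le_sk.
have := near K; rewrite /= => near_k.
have [skE|skN] := eqVneq (s K) K.
  rewrite skE; apply: swaps_keep; apply: IH => [|i]; first by lia.
  have := stab i; have [->|iK] := eqVneq i K; first by rewrite skE.
  have : s i != K by rewrite -skE (inj_eq perm_inj).
  by move: iK; rewrite -!val_eqE /=; lia.
have skS : s K = k.+1 :> nat by move: skN; rewrite -val_eqE /=; lia.
have lt_k1_n : (k.+1 < n)%N by rewrite -skS.
pose K1 := Ordinal lt_k1_n.
have skK1 : s K = K1 by apply: val_inj.
(* The preimage of [K] is at least [k] by stability, within one of [k], and not [K] itself. *)
have sK1 : s K1 = K.
  pose j := (s^-1)%g K; have sj : s j = K by rewrite permKV.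
  have := near j; have := stab j; rewrite sj /= leqnn.
  have jK : j != K by apply: contraNneq skN => jK; rewrite -{1}jK sj.
  move: jK; rewrite -val_eqE /= => jK le_kj near_j.
  have -> // : K1 = j by apply: val_inj => /=; lia.
rewrite !(dropE _ k.+1) //.
rewrite (zc K1) sK1 skK1; apply: swaps_swap; apply: IH => [|i]; first by lia.
have := stab i.
have [->|iK] := eqVneq i K; first by rewrite skK1 /=; lia.
have [->|iK1] := eqVneq i K1; first by rewrite sK1 /=; lia.
have : s i != K1 by rewrite -skK1 (inj_eq perm_inj).
have : s i != K by rewrite -sK1 (inj_eq perm_inj).
by move: iK iK1; rewrite -!val_eqE /=; lia.
Qed.

(** * Pairs of readers and the certificate of correction *)

Definition advance (P : seq word) (u : word) (a : bool) : option word :=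
  let t := rcons u a in
  if t \in P then Some [::] else if has (prefix t) P then Some t else None.

Definition run (P : seq word) (u : option word) (c : word) : option word :=
  foldl (fun u a => obind (advance P ^~ a) u) u c.

Lemma run_None P c : run P None c = None.
Proof. by elim: c. Qed.

Lemma run_star P c : all (fun p => run P (Some [::]) p == Some [::]) P ->
  kleene_star P c -> run P (Some [::]) c = Some [::].
Proof.
move=> /allP runP [ws wsP ->]; elim: ws wsP => //= p ws IH wsP.
rewrite /run foldl_cat -/(run P _ p).
rewrite (eqP (runP p _)) ?wsP ?mem_head //.
by apply: IH => q qws; rewrite wsP // inE qws orbT.
Qed.

Definition reader : Type := (word * option bool)%type.

Definition start : reader := ([::], None).

(** A transition records the input bit, the output bit and the next reader. *)
Definition reader_step P (x : reader) : seq (bool * bool * reader) :=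
  flatten [seq if advance P x.1 a is Some u then
                 [seq (a, e.1, (u, e.2)) | e <- emit x.2 a] else [::]
          | a <- [:: false; true]].

Definition state : Type := (reader * reader * bool)%type.

Definition successors P (x : state) : seq state :=
  let: (l, r, d) := x in
  [seq (s.2, t.2, d || (s.1.1 != t.1.1)) |
     s <- reader_step P l, t <- [seq t <- reader_step P r | t.1.2 == s.1.2]].

(* [k] is only fuel: the result is certified by [separating], not by the way it
   is computed. *)
Fixpoint explore P k (seen todo : seq state) : seq state :=
  if k is k'.+1 then
    if todo is x :: todo' then
      if x \in seen then explore P k' seen todo'
      else explore P k' (x :: seen) (successors P x ++ todo')
    else seen
  else seen.

Definition separating P (reach : seq state) : bool :=
  [&& (start, start, false) \in reach, (start, start, true) \notin reach
    & all (fun x => all (mem reach) (successors P x)) reach].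

Lemma run_cons P u a c : run P (Some u) (a :: c) = Some [::] ->
  exists2 u', advance P u a = Some u' & run P (Some u') c = Some [::].
Proof.
rewrite /run /=; case: advance => [u' h|]; first by exists u'.
by rewrite -/(run P None c) run_None.
Qed.

Lemma mem_reader_step P u u' p a e : advance P u a = Some u' -> e \in emit p a ->
  (a, e.1, (u', e.2)) \in reader_step P (u, p).
Proof.
move=> adv ep; apply/flatten_mapP; exists a; first by case: (a).
by rewrite adv; apply/mapP; exists e.
Qed.

(** Induction on the common output: each bit moves both readers along one edge inside the closed
    set, and the flag collects the differences of the inputs. At the end no word and no swap is
    pending, so both readers are at [start]. *)
Lemma separating_sync P reach u v p q d c c' z : separating P reach ->
  (u, p, (v, q), d) \in reach ->
  run P (Some u) c = Some [::] -> swaps p c z ->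
  run P (Some v) c' = Some [::] -> swaps q c' z ->
  (start, start, d || (c != c')) \in reach.
Proof.
case/and3P=> _ _ /allP closed.
elim: z u v p q d c c' => [|o z IH] u v p q d [|a c] [|b c'] inS //.
  by move=> [uE] /eqP pE [vE] /eqP qE; move: inS; rewrite uE vE pE qE orbF.
move=> /run_cons[u' advu runu] /hasP[e ep /andP[/eqP eo swc]].
move=> /run_cons[v' advv runv] /hasP[e' eq' /andP[/eqP eo' swc']].
rewrite eqseq_cons negb_and orbA.
apply: (IH u' v' e.2 e'.2) => //.
apply: (allP (closed _ inS)); rewrite /successors.
apply/allpairsPdep; exists (a, e.1, (u', e.2)), (b, e'.1, (v', e'.2)); split => //.
  exact: mem_reader_step.
by rewrite mem_filter mem_reader_step //= eo eo' eqxx.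
Qed.

Lemma separating_correcting P reach :
  all (fun p => run P (Some [::]) p == Some [::]) P -> separating P reach ->
  forall n, correcting (code P n).
Proof.
move=> runP sepS n c c'; rewrite !inE => star_c star_c' cc'.
have runc := run_star _ _ runP star_c.
have runc' := run_star _ _ runP star_c'.
apply/pred0P => z /=; apply/negP => /andP[/ball_swaps swc /ball_swaps swc'].
have /and3P[inS /negP notinS _] := sepS; apply: notinS.
by have := separating_sync _ _ _ _ _ _ _ _ _ _ sepS inS runc swc
  runc' swc'; rewrite (val_eqE c c') cc'.
Qed.

Lemma correcting_P2 n : correcting (code P2 n).
Proof.
(* The fuel suffices: the second computation checks that the set found is closed. *)
apply: (@separating_correcting _
  (explore P2 3000 [::] [:: (start, start, false)])).
  by vm_compute.
by vm_compute.
Qed.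

(** * Unique factorisation and the recursion for code sizes *)

Definition prefix_code (P : seq word) : bool :=
  [&& uniq P, [::] \notin P
    & all (fun p => all (fun q => prefix p q ==> (p == q)) P) P].

Lemma kleene_star_cat P p w : p \in P -> kleene_star P w -> kleene_star P (p ++ w).
Proof.
move=> pP [ws wsP ->]; exists (p :: ws) => // q.
by rewrite inE => /predU1P[->|/wsP].
Qed.

Lemma prefix_cat_prefix (p q v w : word) :
  p ++ v = q ++ w -> prefix p q || prefix q p.
Proof.
elim: p q => [|a p IH] [|b q] //= [-> /IH].
by rewrite eqxx.
Qed.

Lemma prefix_code_cat P p q v w : prefix_code P -> p \in P -> q \in P ->
  p ++ v = q ++ w -> p = q /\ v = w.
Proof.
case/and3P=> _ _ /allP pref pP qP vw.
have pq : p = q.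
  have /allP/(_ _ qP)/implyP pq := pref _ pP.
  have /allP/(_ _ pP)/implyP qp := pref _ qP.
  by case/orP: (prefix_cat_prefix _ _ _ _ vw) => [/pq|/qp] /eqP.
by split=> //; move: vw; rewrite pq => /eqP; rewrite eqseq_cat // eqxx => /eqP.
Qed.

Definition starts_with (P : seq word) (p : word) n : {set n.-tuple bool} :=
  [set c : n.-tuple bool | prefix p c & `[< kleene_star P (drop (size p) c) >]].

Lemma card_starts_with P p n :
  #|starts_with P p n| = if (size p <= n)%N then #|code P (n - size p)| else 0%N.
Proof.
case: leqP => [/subnKC <-|lt_n_p]; last first.
  apply: eq_card0 => c; rewrite !inE; apply/negP => /andP[/prefixP[w cE] _].
  have := size_tuple c; rewrite cE size_cat => sc.
  by rewrite -sc ltnNge leq_addr in lt_n_p.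
move: (n - _)%N => m; rewrite addKn.
pose f (w : m.-tuple bool) : (size p + m).-tuple bool := cat_tuple (in_tuple p) w.
have finj : injective f.
  move=> v w /(congr1 val) /= /eqP; rewrite eqseq_cat // eqxx => /eqP ?.
  exact: val_inj.
rewrite -(card_imset _ finj); apply: eq_card => c; rewrite inE.
apply/andP/imsetP => [[/prefixP[w cE]]|[w]].
  rewrite cE drop_size_cat // => starw.
  have sw : size w == m.
    by rewrite -(eqn_add2l (size p)) -size_cat -cE size_tuple.
  by exists (Tuple sw); [rewrite inE | apply: val_inj; rewrite /= cE].
by rewrite inE => starw ->; rewrite /= prefix_prefix drop_size_cat.
Qed.

(** Double counting of pairs of a codeword and a first factor: as [n] is positive, each codeword has
    a first factor, and only one. *)
Lemma card_code P n : prefix_code P -> (0 < n)%N ->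
  #|code P n| = (\sum_(p <- P | (size p <= n)%N) #|code P (n - size p)|)%N.
Proof.
move=> prefP n_gt0; rewrite big_mkcond /=.
under eq_bigr => p _ do rewrite -card_starts_with -sum1_card big_mkcond.
rewrite exchange_big -sum1_card big_mkcond; apply: eq_bigr => c _ /=.
have [uniqP nilP _] := and3P prefP.
rewrite inE; case: asboolP => [[[|p ws] wsP cE]|notin]; last 1 first.
- rewrite big_seq big1 // => p pP; rewrite inE; case: ifP => // /andP[].
  move=> /prefixP[w cE]; rewrite cE drop_size_cat // => /asboolP starw.
  by case: notin; rewrite cE; apply: kleene_star_cat.
- by have := size_tuple c; rewrite cE /= => n0; rewrite -n0 in n_gt0.
have pP : p \in P by rewrite wsP ?mem_head.
rewrite (bigD1_seq p) //= inE cE prefix_prefix drop_size_cat //.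
rewrite asboolT /=; last by exists ws => // q qws; rewrite wsP // inE qws orbT.
rewrite big_seq_cond big1 ?addn0 // => q /andP[qP qp].
rewrite inE cE; case: ifP => // /andP[/prefixP[w] qE _].
by have [pq _] := prefix_code_cat _ _ _ _ _ prefP pP qP qE; rewrite pq eqxx in qp.
Qed.

Lemma card_code0 P : #|code P 0| = 1%N.
Proof.
apply/eqP; rewrite eqn_leq; apply/andP; split.
  by apply: leq_trans (max_card _) _; rewrite card_tuple.
by apply/card_gt0P; exists [tuple]; rewrite inE; apply/asboolP; exists [::].
Qed.

(** * Kraft sums and exponential bounds *)

Local Open Scope ring_scope.

(** Value 1 says that the powers of [x] solve the recursion for code sizes. *)
Definition kraft_sum (R : fieldType) (P : seq word) (x : R) : R :=
  \sum_(p <- P) x ^- size p.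

(** Termwise comparison of the two recursions; words longer than [n] only enlarge the side of
    [x ^+ n]. *)
Lemma card_code_upper (R : realFieldType) P (x : R) n : prefix_code P -> 0 < x ->
  kraft_sum R P x = 1 -> #|code P n|%:R <= x ^+ n.
Proof.
move=> prefP x_gt0 kraft; elim/ltn_ind: n => n IH.
case: (posnP n) => [->|n_gt0]; first by rewrite card_code0.
rewrite card_code // natr_sum -[leRHS]mulr1 -[X in _ * X]kraft mulr_sumr.
rewrite big_mkcond /=.
rewrite big_seq [leRHS]big_seq; apply: ler_sum => p pP.
case: ifP => [le_p_n|_]; last by rewrite mulr_ge0 ?invr_ge0 ?exprn_ge0 ?ltW.
rewrite -expfB_cond; last by rewrite gt_eqF.
apply: IH; have [_ nilP _] := and3P prefP.
by rewrite ltn_subrL n_gt0 andbT lt0n size_eq0; apply: contraNneq nilP => <-.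
Qed.

(** On the initial window of [L] lengths the constant absorbs [x ^+ n]. Beyond it, removing a word
    of [P] never leads below length [N]. *)
Lemma card_code_lower (R : realFieldType) P (x : R) N L n :
  prefix_code P -> 1 <= x ->
  kraft_sum R P x = 1 -> all (fun p => (size p <= L)%N) P ->
  (forall m, (N <= m < N + L)%N -> (0 < #|code P m|)%N) ->
  (N <= n)%N -> x ^+ n <= x ^+ (N + L) * #|code P n|%:R.
Proof.
move=> prefP x_ge1 kraft /allP sizeP nonempty; elim/ltn_ind: n => n IH le_N_n.
have x_gt0 : 0 < x by apply: lt_le_trans x_ge1.
have [lt_n|ge_n] := ltnP n (N + L).
  rewrite -[leLHS]mulr1 ler_pM ?exprn_ge0 ?(ltW x_gt0) ?ler01 ?ler1n ?nonempty
    ?le_N_n //.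
  exact: ler_weXn2l (ltnW lt_n).
have [_ nilP _] := and3P prefP.
have size_gt0 p : p \in P -> (0 < size p)%N.
  by move=> pP; rewrite lt0n size_eq0; apply: contraNneq nilP => <-.
have P_nonnil : exists p, p \in P.
  case: (P) kraft => [|p P' _]; last by exists p; rewrite mem_head.
  by rewrite /kraft_sum big_nil => /eqP; rewrite eq_sym oner_eq0.
have [p0 p0P] := P_nonnil.
have L_gt0 := leq_trans (size_gt0 _ p0P) (sizeP _ p0P).
rewrite card_code //; last by lia.
rewrite natr_sum -[leLHS]mulr1 -[X in _ * X <= _]kraft !mulr_sumr.
rewrite [leRHS]big_mkcond /=.
rewrite big_seq [leRHS]big_seq; apply: ler_sum => p pP.
move: (size p) (sizeP _ pP) (size_gt0 _ pP) => s s_le s_gt0.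
rewrite ifT; last by lia.
rewrite -expfB_cond; last by rewrite gt_eqF // add0n; lia.
by apply: IH; lia.
Qed.

(** * Word lengths and small codewords of [P2] *)

Lemma prefix_code_P2 : prefix_code P2.
Proof. by vm_compute. Qed.

Lemma kraft_sum_P2 (R : fieldType) (x : R) : kraft_sum R P2 x =
  6 * x ^- 6 + 8 * x ^- 7 + 2 * x ^- 8 + 10 * x ^- 9 + 4 * x ^- 11.
Proof.
have sizeP2 : map size P2 =
    nseq 6 6%N ++ nseq 8 7%N ++ nseq 2 8%N ++ nseq 10 9%N ++ nseq 4 11%N.
  by vm_compute.
rewrite /kraft_sum -(big_map size predT (fun k => x ^- k)) sizeP2.
by rewrite !big_cat !big_nseq !iter_addr_0 /=; ring.
Qed.

Lemma code_gt0 P (ws : seq word) : {subset ws <= P} ->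
  (0 < #|code P (size (flatten ws))|)%N.
Proof.
move=> wsP; apply/card_gt0P; exists (in_tuple (flatten ws)).
by rewrite inE; apply/asboolP; exists ws.
Qed.

Lemma code_P2_gt0 m : (11 <= m < 11 + 11)%N -> (0 < #|code P2 m|)%N.
Proof.
move=> m_bnd.
(* The words 0, 6, 14, 16, 26 of P2 have the lengths 6, 7, 8, 9, 11. *)
pose ws := map (nth [::] P2) (nth [::] [:: [:: 26]; [:: 0; 0]; [:: 0; 6];
  [:: 6; 6]; [:: 6; 14]; [:: 14; 14]; [:: 14; 16]; [:: 16; 16]; [:: 0; 0; 6];
  [:: 0; 6; 6]; [:: 6; 6; 6]] (m - 11))%N.
have /andP[/allP wsP /eqP <-] : all (mem P2) ws && (size (flatten ws) == m).
  have : m \in iota 11 11 by rewrite mem_iota.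
  by rewrite /ws {m_bnd ws}; move: m; apply/allP; vm_compute.
exact: code_gt0.
Qed.

(** * Certified decimals of binary logarithms *)

(* If [x ^+ 10 = 2 ^+ d * y] with [1 <= y < 2], then [d] is the first decimal of
   [log2 x] and the later ones are those of [log2 y]. *)
Lemma log2_digit (R : realType) (x y t : R) (d : nat) : 0 < x -> 0 < y ->
  y * 2 ^+ d <= x ^+ 10 -> t < log2 y -> (d%:R + t) / 10 < log2 x.
Proof.
move=> x_gt0 y_gt0 yx ty; rewrite ltr_pdivrMr //.
have ln2 : 0 < ln 2 :> R by rewrite ln_gt0 // ltr1n.
apply: lt_le_trans (_ : d%:R + log2 y <= _); first by rewrite ltrD2l.
rewrite /log2 -[d%:R](mulfK (lt0r_neq0 ln2)) -mulrDl mulrAC.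
rewrite ler_pM2r ?invr_gt0 //.
rewrite mulr_natl mulr_natr -!lnXn //.
rewrite -lnM ?posrE ?exprn_gt0 // mulrC.
by rewrite ler_ln // ?posrE ?mulr_gt0 ?exprn_gt0.
Qed.

Lemma log2_gt0 (R : realType) (x : R) : 1 < x -> 0 < log2 x.
Proof. by move=> x_gt1; rewrite divr_gt0 ?ln_gt0 // ltr1n. Qed.

Lemma log2_15690285_gt (R : realType) :
  649871%:R / 10 ^+ 6 < log2 (15690285%:R / 10 ^+ 7 : R).
Proof.
(* The decimals of the bound in Horner form. Each witness below is a seven-decimal lower bound for
   the tenth power of the preceding number over [2 ^+ d]. *)
apply: (@le_lt_trans _ _
  ((6%:R + (4%:R + (9%:R + (8%:R + (7%:R + (1%:R + 0) / 10) / 10) / 10) / 10) / 10) / 10));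
  first by lra.
apply: (@log2_digit _ _ (14129550%:R / 10 ^+ 7)); [lra..|].
apply: (@log2_digit _ _ (19822723%:R / 10 ^+ 7)); [lra..|].
apply: (@log2_digit _ _ (18296295%:R / 10 ^+ 7)); [lra..|].
apply: (@log2_digit _ _ (16420696%:R / 10 ^+ 7)); [lra..|].
apply: (@log2_digit _ _ (11135395%:R / 10 ^+ 7)); [lra..|].
apply: (@log2_digit _ _ (14656365%:R / 10 ^+ 7)); [lra..|].
by apply: log2_gt0; lra.
Qed.

(** Serves as an upper bound for the rate, through [log2 (2 / x) = 1 - log2 x]. *)
Lemma log2_12746732_gt (R : realType) :
  350127%:R / 10 ^+ 6 < log2 (12746732%:R / 10 ^+ 7 : R).
Proof.
apply: (@le_lt_trans _ _
  ((3%:R + (5%:R + (0%:R + (1%:R + (2%:R + (7%:R + 0) / 10) / 10) / 10) / 10) / 10) / 10));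
  first by lra.
apply: (@log2_digit _ _ (14154631%:R / 10 ^+ 7)); [lra..|].
apply: (@log2_digit _ _ (10088707%:R / 10 ^+ 7)); [lra..|].
apply: (@log2_digit _ _ (10923330%:R / 10 ^+ 7)); [lra..|].
apply: (@log2_digit _ _ (12092623%:R / 10 ^+ 7)); [lra..|].
apply: (@log2_digit _ _ (16716491%:R / 10 ^+ 7)); [lra..|].
apply: (@log2_digit _ _ (13311935%:R / 10 ^+ 7)); [lra..|].
by apply: log2_gt0; lra.
Qed.

(** * Existence and uniqueness of the root *)

(** Multiplying by [x ^+ 11] makes the equation polynomial, so the intermediate value theorem for
    polynomials applies. *)
Lemma kraft_sum_P2_root (R : rcfType) (a b : R) : 0 < a -> a <= b ->
  a ^+ 11 <= 6 * a ^+ 5 + 8 * a ^+ 4 + 2 * a ^+ 3 + 10 * a ^+ 2 + 4 ->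
  6 * b ^+ 5 + 8 * b ^+ 4 + 2 * b ^+ 3 + 10 * b ^+ 2 + 4 <= b ^+ 11 ->
  exists2 x, a <= x <= b & kraft_sum R P2 x = 1.
Proof.
move=> a_gt0 le_ab pa pb.
pose q : {poly R} := 6 *: 'X^5 + 8 *: 'X^4 + 2 *: 'X^3 + 10 *: 'X^2 + 4%:P.
have qE x : q.[x] = 6 * x ^+ 5 + 8 * x ^+ 4 + 2 * x ^+ 3 + 10 * x ^+ 2 + 4.
  by rewrite /q !hornerE.
have [||x x_bnd /rootP] := @poly_ivt R ('X^11 - q) a b => //.
  rewrite hornerD hornerN hornerXn qE subr_le0 pa.
  by rewrite hornerD hornerN hornerXn qE subr_ge0.
rewrite hornerD hornerN hornerXn => /eqP; rewrite subr_eq0 => /eqP qx.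
exists x => //; have x_neq0 : x != 0.
  by apply: lt0r_neq0; apply: lt_le_trans a_gt0 _; case/andP: x_bnd.
rewrite kraft_sum_P2; apply: (mulfI (expf_neq0 11 x_neq0)).
by rewrite mulr1 [in RHS]qx qE; field.
Qed.

(** Every term decreases strictly in [x], no word being empty. *)
Lemma kraft_sum_inj (R : realFieldType) P (x y : R) :
  prefix_code P -> 0 < x -> 0 < y ->
  kraft_sum R P x = 1 -> kraft_sum R P y = 1 -> x = y.
Proof.
move=> /and3P[_ nilP _]; wlog lt_xy : x y / x < y.
  move=> th x0 y0 kx ky; case: (ltgtP x y) => // h; first exact: th.
  by apply/esym; apply: th.
move=> x_gt0 y_gt0 kx ky; exfalso.
have: kraft_sum R P y < kraft_sum R P x; last by rewrite kx ky ltxx.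
case: P nilP kx {ky} => [_|p P nilP _].
  by rewrite /kraft_sum big_nil => /eqP; rewrite eq_sym oner_eq0.
have term q : q \in p :: P -> y ^- size q < x ^- size q.
  move=> qP; rewrite ltf_pV2 ?posrE ?exprn_gt0 // ltrXn2r ?ltW //.
  by rewrite size_eq0; apply: contraNneq nilP => <-.
rewrite /kraft_sum !big_cons ltr_leD ?term ?mem_head //.
rewrite big_seq [leRHS]big_seq; apply: ler_sum => q qP.
by rewrite ltW // term // inE qP orbT.
Qed.

(** * From two-sided bounds to the rate *)

Local Open Scope classical_set_scope.

(** The error is the logarithm of [a n] to base [x], minus [n]. The hypotheses make it bounded by
    [K], hence negligible against [n]. *)
Lemma growth_exponent (R : realType) (a : nat -> nat) (x : R) K : 1 < x ->
  (forall n, (a n)%:R <= x ^+ n) ->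
  (forall n, (0 < a n)%N -> x ^+ n <= x ^+ K * (a n)%:R) ->
  exists2 e : nat -> R, e =o_\oo (fun n => n%:R : R) &
    forall n, (0 < a n)%N -> (a n)%:R = x `^ (n%:R + e n).
Proof.
move=> x_gt1 upper lower.
have x_gt0 : 0 < x by apply: lt_trans x_gt1.
have lnx_gt0 : 0 < ln x by rewrite ln_gt0.
pose e n := if a n is 0%N then 0 else ln (a n)%:R / ln x - n%:R : R.
have e_bound n : `|e n| <= K%:R.
  rewrite /e; case an : (a n) => [|m]; first by rewrite normr0.
  rewrite -an; have an_gt0 : (0 < a n)%N by rewrite an.
  have an_pos : (a n)%:R \is @Num.pos R by rewrite posrE ltr0n.
  have ub : ln (a n)%:R <= n%:R * ln x.
    by rewrite mulr_natl -lnXn // ler_ln ?posrE ?exprn_gt0.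
  have lb : n%:R * ln x <= K%:R * ln x + ln (a n)%:R.
    rewrite !mulr_natl -!lnXn // -lnM ?posrE ?exprn_gt0 //.
    by rewrite ler_ln ?posrE ?mulr_gt0 ?exprn_gt0 ?lower // ltr0n.
  have {}ub : ln (a n)%:R / ln x <= n%:R by rewrite ler_pdivrMr.
  have {}lb : n%:R - K%:R <= ln (a n)%:R / ln x.
    by rewrite ler_pdivlMr // mulrBl lerBlDl.
  by rewrite ler_norml; apply/andP; split; have := ler0n R K; lra.
exists e.
  apply/eqoP => eps eps_gt0; near=> n.
  apply: le_trans (e_bound n) _; rewrite normr_nat mulrC -ler_pdivrMr //.
  by near: n; exact: nbhs_infty_ger.
move=> n an_gt0; rewrite /powR gt_eqF // /e.
case an : (a n) an_gt0 => [//|m] _.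
by rewrite addrC subrK divfK ?gt_eqF // lnK // posrE ltr0n.
Unshelve. all: by end_near.
Qed.

Lemma rate_of_exponent (R : realType) (C : forall n, {set n.-tuple bool}) (x : R)
    (e : nat -> R) :
  (forall N, exists2 n, (N <= n)%N & C n != finset.set0) ->
  e =o_\oo (fun n => n%:R : R) ->
  (forall n, C n != finset.set0 -> #|C n|%:R = x `^ (n%:R + e n)) ->
  has_asymptotic_rate C (log2 x).
Proof.
move=> infinite eo cardE; split=> //.
apply/cvgrPdist_le => eps eps_gt0; rewrite near_withinE.
(* Adding 1 keeps the denominator positive when [log2 x] is 0. *)
have /eqoP/(_ (eps / (`|log2 x| + 1))) eo' := eo.
have d_gt0 : 0 < `|log2 x| + 1 by rewrite ltr_wpDl.
have {}eo' := eo' (divr_gt0 eps_gt0 d_gt0).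
near=> n => Cn.
have n_gt0 : 0 < n%:R :> R by rewrite ltr0n; near: n; exists 1%N.
have en : `|e n| <= eps / (`|log2 x| + 1) * n%:R.
  by rewrite -[X in _ * X](normr_nat R); near: n; exact: eo'.
have -> : log2 x - log2 (#|C n|%:R : R) / n%:R = - (log2 x * (e n / n%:R)).
  by rewrite cardE // /log2 ln_powR; field; rewrite !gt_eqF ?ln_gt0 ?ltr1n.
rewrite normrN (normrM (log2 x)) (normrM (e n)) (normfV n%:R) (gtr0_norm n_gt0).
apply: le_trans (_ : `|log2 x| * (eps / (`|log2 x| + 1)) <= _).
  by rewrite ler_wpM2l // ler_pdivrMr.
rewrite mulrCA ler_piMr ?(ltW eps_gt0) // ler_pdivrMr // mul1r; lra.
Unshelve. all: by end_near.
Qed.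

Theorem mainTheorem4 (R : realType) :
  (forall n : nat, correcting (code P2 n)) /\
  exists lambda2 : R,
    [/\ unique (fun x : R => 0 < x /\
          6 * x ^- 6 + 8 * x ^- 7 + 2 * x ^- 8 + 10 * x ^- 9 + 4 * x ^- 11 = 1)
          lambda2,
        exists2 e : nat -> R, e =o_\oo (fun n => n%:R : R) &
          forall n : nat, code P2 n != finset.set0 ->
            #|code P2 n|%:R = lambda2 `^ (n%:R + e n),
        has_asymptotic_rate (code P2) (log2 lambda2) &
        `|log2 lambda2 - 649872%:R / 10 ^+ 6| < 10 ^- 6].
Proof.
split; first exact: correcting_P2.
(* A bracket of width [10 ^- 6] at whose ends the polynomial changes sign. *)
have [||||x /andP[x_ge x_le] kraft] :=
  @kraft_sum_P2_root R (15690285%:R / 10 ^+ 7) (15690295%:R / 10 ^+ 7).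
1-4: lra.
have x_gt1 : 1 < x by apply: lt_le_trans x_ge; lra.
have x_gt0 : 0 < x by apply: lt_trans x_gt1.
have code_neq0 n : (code P2 n != finset.set0) = (0 < #|code P2 n|)%N.
  by rewrite card_gt0.
have lower n : (11 <= n)%N -> x ^+ n <= x ^+ (11 + 11) * #|code P2 n|%:R.
  exact: (card_code_lower _ _ _ 11 11 _ prefix_code_P2 (ltW x_gt1)
    kraft isT code_P2_gt0).
have [e eo cardE] : exists2 e : nat -> R, e =o_\oo (fun n => n%:R : R) &
    forall n, code P2 n != finset.set0 -> #|code P2 n|%:R = x `^ (n%:R + e n).
  have [n|n Cn|e eo cardE] :=
    @growth_exponent R (fun n => #|code P2 n|) x (11 + 11) x_gt1.
  - exact: card_code_upper prefix_code_P2 x_gt0 kraft.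
  (* Below length 11 a nonempty code has at least one word, and [x ^+ n] is at most [x ^+ 22]. *)
  - have [/lower //|lt_n] := leqP 11 n.
    rewrite -[leLHS]mulr1 ler_pM ?exprn_ge0 ?(ltW x_gt0) ?ler01 ?ler1n //.
    by rewrite ler_weXn2l ?(ltW x_gt1) //; lia.
  by exists e => // n; rewrite code_neq0; apply: cardE.
exists x; split; [|by exists e| |].
- split; first by rewrite -kraft_sum_P2.
  move=> y [y_gt0]; rewrite -kraft_sum_P2.
  by apply: kraft_sum_inj prefix_code_P2 _ _ _.
(* The lower bound forces a codeword at every length from 11 on. *)
- apply: rate_of_exponent eo cardE => N; exists (N + 11)%N; first exact: leq_addr.
  rewrite code_neq0 -(ltr0n R) -(pmulr_rgt0 _ (exprn_gt0 (11 + 11) x_gt0)).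
  by apply: lt_le_trans (lower _ (leq_addl _ _)); rewrite exprn_gt0.
have ln2 : 0 < ln 2 :> R by rewrite ln_gt0 // ltr1n.
have lo := log2_15690285_gt R.
have hi := log2_12746732_gt R.
have le_log2 (y z : R) : 0 < y -> y <= z -> log2 y <= log2 z.
  move=> y_gt0 le_yz; rewrite ler_pM2r ?invr_gt0 //.
  by rewrite ler_ln ?posrE //; apply: lt_le_trans le_yz.
have {}lo : 649871%:R / 10 ^+ 6 < log2 x.
  by apply: lt_le_trans lo (le_log2 _ _ _ x_ge); lra.
(* 12746732 / 10 ^+ 7 is 2 / x_max rounded down, for the upper bound x_max of x. *)
have {}hi : 350127%:R / 10 ^+ 6 < 1 - log2 x.
  apply: lt_le_trans hi _.
  have -> : 1 - log2 x = log2 (2 / x).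
    by rewrite /log2 ln_div ?posrE // mulrBl divff ?gt_eqF.
  by apply: le_log2; [lra|rewrite ler_pdivlMr //; nra].
by rewrite ltr_norml; apply/andP; split; lra.
Qed.
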